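(* Let $n,k\in\mathbb{N}$ with $k\le n/2$ and let $k\le j\le n-k+1$. Then $$F_q(n,k,j)=P\big(n-k-j+1,\;d_q(n,k),\;e_q(n,k),\;[k]_q\,[n-k+1]_q\big).$$
   Context: $\mathbb{N}=\{0,1,2,\ldots\}$. For $k\in\mathbb{N}$, $[k]_q=1+q+q^2+\cdots+q^{k-1}$ (so $[0]_q=0$), a polynomial in $q$. For $k,n\in\mathbb{N}$ with $k\le n/2$, the polynomials $F_q(n,k,j)$ in $q$, $k\le j\le n-k+1$, are defined recursively by $$F_q(n,k,n-k+1)=1,\qquad F_q(n,k,n-k)=[k]_q+[n-k]_q,$$ and, for $k\le j<n-k$, $$F_q(n,k,j)=([j]_q+[n-j]_q)\,F_q(n,k,j+1)-q^k[j+1-k]_q[n-k-j]_q\,F_q(n,k,j+2).$$ Let $[n]=\{1,\ldots,n\}$ and let $[\overline{n}]=\{\overline{1},\ldots,\overline{n}\}$ be a disjoint copy. Sets $S(n)$ of subsets of $[n]\cup[\overline{n}]$ are defined recursively by $S(0)=\{\emptyset\}$, $S(1)=\{\{1\},\{\overline{1}\}\}$ and, for $n\ge 1$, $$S(n+1)=\{X\cup\{n+1\}:X\in S(n)\}\cup\{X\cup\{\overline{n+1}\}:X\in S(n),\ n\notin X\}\cup S(n-1).$$ (Each $X\in S(n)$ has $0\le |X|\le n$ and $|X|\equiv n \pmod 2$.) For sequences of indeterminates $\mathbf{x}=(x_1,x_2,\ldots)$, $\mathbf{y}=(y_1,y_2,\ldots)$ and an indeterminate $z$, define for $n\ge 0$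 the polynomial $$P(n,\mathbf{x},\mathbf{y},z)=\sum_{X\in S(n)}\Big(\prod_{i\in X\cap[n]}x_i\Big)\Big(\prod_{\overline{i}\in X\cap[\overline{n}]}y_i\Big)z^{\frac{n-|X|}{2}}.$$ For $n,k\in\mathbb{N}$ with $k\le n/2$ define the sequences $$d_q(n,k)=([n-k]_q,[n-k-1]_q,\ldots,[k]_q,0,0,\ldots),\qquad e_q(n,k)=([k]_q,[k+1]_q,\ldots,[n-k]_q,0,0,\ldots).$$ In the claim, $P$ is evaluated by substituting $\mathbf{x}=d_q(n,k)$, $\mathbf{y}=e_q(n,k)$, $z=[k]_q[n-k+1]_q$. *)

(* Defs.v *)
From mathcomp Require Import all_boot all_order all_algebra.
From mathcomp Require Import finmap.

Set Implicit Arguments.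
Unset Strict Implicit.
Unset Printing Implicit Defensive.

Import GRing.Theory.
Local Open Scope ring_scope.

(* Polynomials in q are elements of {poly int}, with q := 'X. *)
Definition qint (k : nat) : {poly int} := \sum_(i < k) 'X^i.

(* The recursion defining F_q(n,k,j) runs downwards in j, so Faux recurses on
   m = n - k + 1 - j.  All the truncated subtractions are exact for
   2 * k <= n and k <= j <= n - k + 1; outside that range the values of F are
   irrelevant.  Faux is only an encoding device: F_top, F_pretop and F_rec
   below are the defining equations of F_q. *)
Fixpoint Faux (n k m : nat) {struct m} : {poly int} :=
  match m with
  | 0 => 1
  | m1.+1 =>
    match m1 with
    | 0 => qint k + qint (n - k)
    | m2.+1 =>
      let j := (n - k + 1 - m)%N in
      (qint j + qint (n - j)) * Faux n k m1
      - 'X^k * qint (j + 1 - k) * qint (n - k - j) * Faux n k m2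
    end
  end.

Definition F (n k j : nat) : {poly int} := Faux n k (n - k + 1 - j).

Lemma F_top (n k : nat) : F n k (n - k + 1) = 1.
Proof. by rewrite /F subnn. Qed.

Lemma F_pretop (n k : nat) : F n k (n - k) = qint k + qint (n - k).
Proof. by rewrite /F addnC addnK. Qed.

Lemma F_rec (n k j : nat) : (k <= j < n - k)%N ->
  F n k j = (qint j + qint (n - j)) * F n k (j + 1)
            - 'X^k * qint (j + 1 - k) * qint (n - k - j) * F n k (j + 2).
Proof.
case/andP=> _ ltj; rewrite /F.
have Em : (n - k + 1 - j)%N = (n - k - j.+1).+2.
  by rewrite addn1 subSn 1?ltnW // -subSS subSn.
have -> : (n - k + 1 - (j + 1))%N = (n - k - j.+1).+1.
  by rewrite !addn1 subSn.
have -> : (n - k + 1 - (j + 2))%N = (n - k - j.+1)%N.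
  by rewrite addn1 addn2 subSS.
rewrite Em /= -Em subKn //.
by rewrite addn1 leqW // ltnW.
Qed.

(* inl i stands for i, inr i for the barred copy of i. *)
Definition letter : choiceType := (nat + nat)%type.

Local Open Scope fset_scope.

Fixpoint S_sets (n : nat) {struct n} : {fset {fset letter}} :=
  match n with
  | 0 => [fset fset0]
  | n1.+1 =>
    match n1 with
    | 0 => [fset [fset (inl 1%N : letter)]; [fset (inr 1%N : letter)]]
    | n2.+1 =>
      [fset X `|` [fset (inl n : letter)] | X in S_sets n1]
      `|` [fset X `|` [fset (inr n : letter)]
          | X in S_sets n1 & (inl n1 : letter) \notin X]
      `|` S_sets n2
    end
  end.

(* The polynomial P(n,x,y,z), given by its values in an arbitrary commutative
   ring.  Sequences are indexed from 1: x i is x_i, and x 0 is never used.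
   Every X in S_sets n has #|X| <= n and #|X| = n mod 2, so the exponent of z
   is exact. *)
Definition P (R : comNzRingType) (n : nat) (x y : nat -> R) (z : R) : R :=
  \sum_(X <- S_sets n)
    (\prod_(1 <= i < n.+1 | (inl i : letter) \in X) x i)
    * (\prod_(1 <= i < n.+1 | (inr i : letter) \in X) y i)
    * z ^+ ((n - #|` X|) %/ 2).

Definition d_q (n k i : nat) : {poly int} :=
  if (1 <= i <= n - 2 * k + 1)%N then qint (n - k + 1 - i) else 0.

Definition e_q (n k i : nat) : {poly int} :=
  if (1 <= i <= n - 2 * k + 1)%N then qint (k + i - 1) else 0.

(* Main.v *)
Require Import Defs.
From mathcomp Require Import all_boot all_order all_algebra.
From mathcomp Require Import finmap.
From mathcomp Require Import zify ring.

Import GRing.Theory.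

(** The two sides are solutions of the same three-term recurrence in
    $m = n-k+1-j$.

    Write $A_m$ for $P(m,x,y,z)$, with arbitrary values $x$, $y$, $z$, and
    $B_m$ for the part of the sum that comes from the sets without the unbarred
    letter $m$.  The three kinds of sets in $S(m+2)$ give
    $A_{m+2} = x_{m+2}A_{m+1} + y_{m+2}B_{m+1} + zA_m$ and
    $B_{m+2} = y_{m+2}B_{m+1} + zA_m$, so that $A_{m+1} = x_{m+1}A_m + B_{m+1}$
    for all $m$.  Eliminating $B$,
    $$A_{m+2} = (x_{m+2}+y_{m+2})A_{m+1} + (z - x_{m+1}y_{m+2})A_m$$
    (lemma [P_rec]).  The only care needed is that the three kinds of sets are
    disjoint and that each is obtained once, which holds because the letters of
    a set in $S(m)$ have index at most $m$ ([S_sets_bounded]).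

    For $x = d_q(n,k)$, $y = e_q(n,k)$ and $z = [k]_q[n-k+1]_q$, at index
    $m = n-k+1-j$ one has $x_m = [j]_q$, $y_m = [n-j]_q$ and
    $x_{m-1} = [j+1]_q$, and the second coefficient is evaluated by
    $$[k]_q[k+a+b]_q - [k+a]_q[k+b]_q = -q^k[a]_q[b]_q$$
    ([qint_mulB]) with $a = j+1-k$ and $b = n-k-j$.  This is the recursion that
    defines $F_q(n,k,j)$, and the initial values agree. *)

(** * The recurrence for P *)

Section Recurrence.

Local Open Scope fset_scope.
Local Open Scope ring_scope.

(** The bounds on the letters make the letters n+1 and n+2 new for S (n), so
    that adding one of them is injective and produces new sets.  The bound on
    the cardinal makes the truncated exponent of z in P grow by exactly 1 when
    a set of S (n) is counted in S (n+2). *)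
Lemma S_sets_bounded (n : nat) (X : {fset letter}) : X \in S_sets n ->
  [/\ #|` X| <= n,
      forall i, (inl i : letter) \in X -> i <= n
    & forall i, (inr i : letter) \in X -> i <= n]%N.
Proof.
pose bounded m := forall X : {fset letter}, X \in S_sets m ->
  [/\ #|` X| <= m, forall i, (inl i : letter) \in X -> i <= m
    & forall i, (inr i : letter) \in X -> i <= m]%N.
suff bnd m : bounded m /\ bounded m.+1 by case: (bnd n) => + _; exact.
elim: m => [|m [bnd0 bnd1]].
  split=> Y /=.
    by rewrite inE => /eqP->; rewrite cardfs0; split=> // i; rewrite inE.
  rewrite !inE => /orP[] /eqP->; rewrite cardfs1;
    by split=> // i; rewrite inE // => /eqP[->].
split=> // Y; rewrite -[S_sets m.+2]/(_ `|` _ `|` S_sets m) !in_fsetU -orbA.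
have add_letter (Z : {fset letter}) (a : letter) : Z \in S_sets m.+1 ->
    a = inl m.+2 \/ a = inr m.+2 ->
    [/\ #|` Z `|` [fset a]| <= m.+2,
      forall i, (inl i : letter) \in Z `|` [fset a] -> i <= m.+2
    & forall i, (inr i : letter) \in Z `|` [fset a] -> i <= m.+2]%N.
  move=> /bnd1[cZ lZ rZ] Da; split.
  - by rewrite fsetUC cardfsU1; case: (_ \notin _); rewrite ?ltnS // leqW.
  - move=> i; rewrite !inE => /orP[/lZ/leqW //|/eqP Di].
    by case: Da Di => -> // [->].
  - move=> i; rewrite !inE => /orP[/rZ/leqW //|/eqP Di].
    by case: Da Di => -> // [->].
case/or3P=> [/imfsetP[Z /= SZ ->]|/imfsetP[Z /=]|/bnd0[cY lY rY]].
- by apply: add_letter => //; left.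
- by rewrite inE => /andP[SZ _] ->; apply: add_letter => //; right.
- by split=> [|i /lY le_m|i /rY le_m]; rewrite !leqW.
Qed.

Lemma fsetU1_inj (T : choiceType) (a : T) (A B : {fset T}) :
  a \notin A -> a \notin B -> A `|` [fset a] = B `|` [fset a] -> A = B.
Proof.
move=> aA aB eqAB; apply/fsetP=> b; have /fsetP/(_ b) := eqAB.
by rewrite !inE; case: eqP => [->|_]; rewrite ?orbF // (negPf aA) (negPf aB).
Qed.

(** The union in the recursive definition of S is disjoint and its two images
    are taken along injective maps, so that the definition splits sums. *)
Lemma perm_S_sets (n : nat) :
  perm_eq (S_sets n.+2)
    ([seq X `|` [fset (inl n.+2 : letter)] | X : {fset letter} <- S_sets n.+1]
     ++ [seq X `|` [fset (inr n.+2 : letter)] |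
          X : {fset letter} <- S_sets n.+1 & (inl n.+1 : letter) \notin X]
     ++ S_sets n).
Proof.
have newl m (X : {fset letter}) : (m <= n.+1)%N -> X \in S_sets m ->
    (inl n.+2 : letter) \notin X.
  by move=> le_mn /S_sets_bounded[_ lX _]; apply/negP=> /lX; lia.
have newr m (X : {fset letter}) : (m <= n.+1)%N -> X \in S_sets m ->
    (inr n.+2 : letter) \notin X.
  by move=> le_mn /S_sets_bounded[_ _ rX]; apply/negP=> /rX; lia.
apply: uniq_perm; first exact: fset_uniq.
  rewrite !cat_uniq !map_inj_in_uniq ?filter_uniq ?fset_uniq ?andbT //;
    first last.
  - move=> X Y SX SY.
    exact: fsetU1_inj (newl _ _ (leqnn _) SX) (newl _ _ (leqnn _) SY).
  - move=> X Y; rewrite !mem_filter => /andP[_ SX] /andP[_ SY].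
    exact: fsetU1_inj (newr _ _ (leqnn _) SX) (newr _ _ (leqnn _) SY).
  rewrite !andTb; apply/andP; split; apply/hasPn=> X.
    rewrite mem_cat => /orP[/mapP[Y]|SX].
      rewrite mem_filter => /andP[_ SY] ->.
      apply/mapP=> -[Z _] /fsetP/(_ (inl n.+2)).
      by rewrite !inE eqxx orbT orbF (negPf (newl _ _ (leqnn _) SY)).
    apply/mapP=> -[Z _ DX]; have /negP[] := newl _ _ (leqnSn n) SX.
    by rewrite DX !inE eqxx orbT.
  move=> SX; apply/mapP=> -[Z _ DX]; have /negP[] := newr _ _ (leqnSn n) SX.
  by rewrite DX !inE eqxx orbT.
move=> X; rewrite -[S_sets n.+2]/(_ `|` _ `|` S_sets n) !in_fsetU !mem_cat.
rewrite -orbA.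
congr [|| _, _ | _].
  by apply/imfsetP/mapP => -[Y]; exists Y.
apply/imfsetP/mapP => -[Y /=].
  by rewrite inE => /andP[SY nY] ->; exists Y; rewrite // mem_filter nY.
by rewrite mem_filter => /andP[nY SY] ->; exists Y; rewrite //= inE SY.
Qed.

Variables (R : comNzRingType) (x y : nat -> R) (z : R).

Definition monomial (n : nat) (X : {fset letter}) : R :=
  (\prod_(1 <= i < n.+1 | (inl i : letter) \in X) x i)
  * (\prod_(1 <= i < n.+1 | (inr i : letter) \in X) y i)
  * z ^+ ((n - #|` X|) %/ 2).

(** With p and q the membership predicates of a set after and before the letter
    n+1 is added to it, this detaches the contribution of that letter. *)
Lemma prod_letters_recr (n : nat) (p q : pred nat) (f : nat -> R) :
    {in gtn n.+1, p =1 q} ->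
  \prod_(1 <= i < n.+2 | p i) f i
    = (\prod_(1 <= i < n.+1 | q i) f i) * (if p n.+1 then f n.+1 else 1).
Proof.
move=> eq_pq; rewrite big_mkcond big_nat_recr //=; congr (_ * _).
by rewrite [RHS]big_mkcond; apply: eq_big_nat => i /andP[_ lt_i]; rewrite eq_pq.
Qed.

Lemma monomial_addl (n : nat) (X : {fset letter}) : X \in S_sets n ->
  monomial n.+1 (X `|` [fset (inl n.+1 : letter)]) = x n.+1 * monomial n X.
Proof.
case/S_sets_bounded=> _ lX rX; rewrite /monomial.
rewrite (@prod_letters_recr _ _ (fun i => (inl i : letter) \in X) x); last first.
  move=> i; rewrite !inE => lt_i; case: eqP => [[Di]|_]; last by rewrite orbF.
  by rewrite Di ltnn in lt_i.
rewrite (@prod_letters_recr _ _ (fun i => (inr i : letter) \in X) y); last first.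
  by move=> i; rewrite !inE orbF.
rewrite !inE eqxx orbT orbF ifN; last by apply/negP=> /rX; rewrite ltnn.
rewrite fsetUC cardfsU1 [inl _ \notin _](_ : _ = true); last first.
  by apply/negP=> /lX; rewrite ltnn.
by rewrite add1n subSS; ring.
Qed.

Lemma monomial_addr (n : nat) (X : {fset letter}) : X \in S_sets n ->
  monomial n.+1 (X `|` [fset (inr n.+1 : letter)]) = y n.+1 * monomial n X.
Proof.
case/S_sets_bounded=> _ lX rX; rewrite /monomial.
rewrite (@prod_letters_recr _ _ (fun i => (inl i : letter) \in X) x); last first.
  by move=> i; rewrite !inE orbF.
rewrite (@prod_letters_recr _ _ (fun i => (inr i : letter) \in X) y); last first.
  move=> i; rewrite !inE => lt_i; case: eqP => [[Di]|_]; last by rewrite orbF.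
  by rewrite Di ltnn in lt_i.
rewrite !inE eqxx orbT orbF ifN; last by apply/negP=> /lX; rewrite ltnn.
rewrite fsetUC cardfsU1 [inr _ \notin _](_ : _ = true); last first.
  by apply/negP=> /rX; rewrite ltnn.
by rewrite add1n subSS; ring.
Qed.

Lemma monomial_skip (n : nat) (X : {fset letter}) : X \in S_sets n ->
  monomial n.+2 X = z * monomial n X.
Proof.
case/S_sets_bounded=> cX lX rX; rewrite /monomial.
rewrite !(@prod_letters_recr _ _ (fun i => (inl i : letter) \in X) x) //.
rewrite !(@prod_letters_recr _ _ (fun i => (inr i : letter) \in X) y) //.
rewrite !ifN ?mulr1; try by apply/negP=> /lX; lia.
all: try by apply/negP=> /rX; lia.
have -> : ((n.+2 - #|` X|) %/ 2 = ((n - #|` X|) %/ 2).+1)%N by lia.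
by rewrite exprS; ring.
Qed.

(** The part of P (n, x, y, z) from the sets to which the barred letter n+1 may
    be added. *)
Definition Pnotl (n : nat) : R :=
  \sum_(X <- S_sets n | (inl n : letter) \notin X) monomial n X.

Lemma P_split (n : nat) :
  P n.+2 x y z = x n.+2 * P n.+1 x y z + (y n.+2 * Pnotl n.+1 + z * P n x y z).
Proof.
rewrite /P (perm_big _ (perm_S_sets n)) !big_cat !big_map big_filter.
rewrite !mulr_sumr; congr (_ + (_ + _)).
- rewrite [LHS]big_seq [RHS]big_seq; apply: eq_bigr => X.
  exact: monomial_addl.
- rewrite [LHS]big_seq_cond [RHS]big_seq_cond; apply: eq_bigr => X /andP[SX _].
  exact: monomial_addr.
- rewrite [LHS]big_seq [RHS]big_seq; apply: eq_bigr => X.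
  exact: monomial_skip.
Qed.

Lemma Pnotl_split (n : nat) :
  Pnotl n.+2 = y n.+2 * Pnotl n.+1 + z * P n x y z.
Proof.
rewrite /Pnotl /P (perm_big _ (perm_S_sets n)) !big_cat !big_map.
rewrite big_filter_cond.
(* The sets that receive the unbarred letter n+2 are left out of Pnotl. *)
rewrite big1 => [|X]; last by rewrite !inE eqxx orbT.
rewrite [LHS]Monoid.mul1m !mulr_sumr; congr (_ + _).
- rewrite [LHS]big_seq_cond [RHS]big_seq_cond.
  apply: eq_big => X; last by case/andP=> SX _; exact: monomial_addr.
  apply: andb_id2l => /S_sets_bounded[_ lX _].
  rewrite !inE orbF; case: (boolP (inl n.+2 \in X)) => [/lX|_].
    by rewrite ltnn.
  by rewrite andbT.
- rewrite [LHS]big_seq_cond [RHS]big_seq.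
  apply: eq_big => X; last by case/andP=> SX _; exact: monomial_skip.
  apply: andb_idr => /S_sets_bounded[_ lX _].
  by apply/negP=> /lX; lia.
Qed.

Lemma monomial0 : monomial 0 fset0 = 1.
Proof. by rewrite /monomial !big_geq // cardfs0 !mulr1. Qed.

Lemma P0 : P 0 x y z = 1.
Proof. by rewrite /P big_seq_fset1 -[RHS]monomial0. Qed.

Lemma big_S_sets1 (G : {fset letter} -> R) :
  \sum_(X <- S_sets 1) G X
    = G [fset (inl 1%N : letter)] + G [fset (inr 1%N : letter)].
Proof.
rewrite big_fsetU1 ?big_seq_fset1 // inE; apply/negP=> /eqP/fsetP/(_ (inl 1%N)).
by rewrite !inE eqxx.
Qed.

Lemma monomial1l : monomial 1 [fset (inl 1%N : letter)] = x 1%N.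
Proof.
by rewrite -[[fset _]]fset0U monomial_addl ?inE // monomial0 mulr1.
Qed.

Lemma monomial1r : monomial 1 [fset (inr 1%N : letter)] = y 1%N.
Proof.
by rewrite -[[fset _]]fset0U monomial_addr ?inE // monomial0 mulr1.
Qed.

Lemma P1 : P 1 x y z = x 1%N + y 1%N.
Proof. by rewrite /P big_S_sets1 -monomial1l -monomial1r. Qed.

Lemma Pnotl1 : Pnotl 1 = y 1%N.
Proof.
by rewrite /Pnotl big_mkcond big_S_sets1 !inE eqxx add0r monomial1r.
Qed.

(** Eliminating Pnotl between [P_split] and [Pnotl_split] is what turns the
    side condition in the definition of S into the product x_(n+1) y_(n+2) of
    [P_rec]: a barred n+2 may multiply every set except those of the form
    X + (n+1). *)
Lemma Pnotl_P (n : nat) : Pnotl n.+1 = P n.+1 x y z - x n.+1 * P n x y z.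
Proof.
case: n => [|n]; first by rewrite Pnotl1 P1 P0; ring.
by rewrite Pnotl_split P_split; ring.
Qed.

Lemma P_rec (n : nat) :
  P n.+2 x y z = (x n.+2 + y n.+2) * P n.+1 x y z
                 + (z - x n.+1 * y n.+2) * P n x y z.
Proof. by rewrite P_split Pnotl_P; ring. Qed.

End Recurrence.

(** * q-integers *)

Section QIntegers.

Local Open Scope ring_scope.

Lemma qint_subX1 (n : nat) : ('X - 1) * qint n = 'X^n - 1 :> {poly int}.
Proof. by rewrite subrX1. Qed.

(** After multiplication by (q - 1)^2, which is regular, every q-integer becomes
    a difference of powers of q and the identity is one between monomials. *)
Lemma qint_mulB (k a b : nat) :
  qint k * qint (k + a + b) - qint (k + a) * qint (k + b)
    = - ('X^k * qint a * qint b).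
Proof.
have X1_neq0 : ('X - 1 : {poly int}) ^+ 2 != 0.
  by rewrite expf_neq0 // polyXsubC_eq0.
apply: (mulfI X1_neq0).
transitivity (('X - 1) * qint k * (('X - 1) * qint (k + a + b))
              - ('X - 1) * qint (k + a) * (('X - 1) * qint (k + b))); first by ring.
rewrite !qint_subX1.
transitivity (- ('X^k * (('X - 1) * qint a) * (('X - 1) * qint b))); last by ring.
by rewrite !qint_subX1 !exprD; ring.
Qed.

Lemma Faux_rec (n k m : nat) (j := (n - k + 1 - m.+2)%N) :
  Faux n k m.+2 = (qint j + qint (n - j)) * Faux n k m.+1
                  - 'X^k * qint (j + 1 - k) * qint (n - k - j) * Faux n k m.
Proof. by []. Qed.

End QIntegers.

(** * The identity between F and P *)

Theorem theorem3p2 (n k j : nat) (hk : (2 * k <= n)%N)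
    (hj : (k <= j <= n - k + 1)%N) :
  F n k j = P (n - k + 1 - j) (d_q n k) (e_q n k)
              (qint k * qint (n - k + 1))%R.
Proof.
have Dd i m : (0 < m <= n - 2 * k + 1)%N -> (i + m = n - k + 1)%N ->
  d_q n k m = qint i.
  by move=> hm Dm; rewrite /d_q hm -Dm addnK.
have De i m : (0 < m <= n - 2 * k + 1)%N -> (i + 1 = k + m)%N ->
  e_q n k m = qint i.
  by move=> hm Di; rewrite /e_q hm -Di addnK.
have: (n - k + 1 - j <= n - 2 * k + 1)%N by lia.
rewrite /F; move: (n - k + 1 - j)%N => m {j hj}.
elim/ltn_ind: m => -[|[|m]] IHm le_m; first by rewrite P0.
  have Dx : d_q n k 1 = qint (n - k) by apply: Dd; lia.
  have Dy : e_q n k 1 = qint k by apply: De; lia.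
  by rewrite P1 Dx Dy [RHS]addrC.
have IH0 := IHm m (ltnW (ltnSn _)) (ltnW (ltnW le_m)).
have IH1 := IHm m.+1 (ltnSn _) (ltnW le_m).
rewrite P_rec -IH0 -IH1 Faux_rec.
have [j Dj] : exists j, (n - k + 1 = j + m.+2)%N.
  by exists (n - k + 1 - m.+2)%N; lia.
rewrite Dj addnK.
have [a Da] : exists a, (j.+1 = k + a)%N by exists (j.+1 - k)%N; lia.
have Db : (n - j = k + m.+1)%N by lia.
have Dx : d_q n k m.+2 = qint j by apply: Dd; lia.
have Dy : e_q n k m.+2 = qint (n - j) by apply: De; lia.
have Dx1 : d_q n k m.+1 = qint j.+1 by apply: Dd; lia.
rewrite Dx Dy Dx1.
have -> : (j + m.+2 = k + a + m.+1)%N by lia.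
(* Now z - x_(m+1) y_(m+2) has the shape of qint_mulB, with b = m + 1. *)
rewrite Db Da qint_mulB addn1 Da addKn.
have -> : (n - k - j = m.+1)%N by lia.
by rewrite mulNr.
Qed.
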